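(* Consider the sliding-window MDP with states $\kappa_t\in\mathbb{W}$ and its finite approximation $\mathrm{MDP}_N$ described in the context, with discount factor $\beta\in(0,1)$. Let $\hat\gamma_N^*:\hat{\mathbb{W}}\to\mathcal{Q}\times\mathcal{H}$ be an optimal policy for $\mathrm{MDP}_N$ and let $\tilde\gamma_N^*(\pi,I)=\hat\gamma_N^*(\mu,I)$ be its extension over $\mathcal{P}(\mathbb{X})$, i.e. to $\mathbb{W}$. Then for any $\gamma\in\Gamma_{C-P}$ which is applied $N$ times starting from $\pi_{-N}$ to generate $\kappa_0$, $$E^\gamma_{\pi_{-N}}\big[J_\beta(\kappa_0,\tilde\gamma_N^* )-J_\beta(\kappa_0)\big]\le\frac{4\|c\|_\infty}{(1-\beta)^2}\Big(2\big(1-\min_{u\in\mathbb{U}}\delta(P,u)\big)\Big)^N.$$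
   Context: $\mathbb{X}$ (states), $\mathbb{U}$ (actions), $\mathbb{M}$ (channel symbols) are finite nonempty sets; $P(x'\mid x,u)$ is the transition kernel of the controlled source $x_{t+1}=f(x_t,u_t,w_t)$, $w_t$ i.i.d.; $c:\mathbb{X}\times\mathbb{U}\to\mathbb{R}$ is a cost, $\|c\|_\infty=\max_{x,u}|c(x,u)|$. $\mathcal{Q}=\{Q:\mathbb{X}\to\mathbb{M}\}$, $\mathcal{H}=\{\eta:\mathcal{Q}\times\mathbb{M}\to\mathbb{U}\}$; $\mathcal{P}(\mathbb{X})$ is the set of probability measures on $\mathbb{X}$. Dynamics: time starts at $-N$ with $x_{-N}\sim\pi_{-N}\in\mathcal{P}(\mathbb{X})$; given $(Q_t,\eta_t)$, $q_t=Q_t(x_t)$, $u_t=\eta_t(Q_t,q_t)$, and $\pi_{t+1}=F(\pi_t,Q_t,\eta_t,q_t)$ with $$F(\pi,Q,\eta,q)(x')=\frac{1}{\pi(Q^{-1}(q))}\sum_{x\in Q^{-1}(q)}P(x'\mid x,\eta(Q,q))\pi(x)$$ (value arbitrary if $\pi(Q^{-1}(q))=0$). A policy in $\Gamma_{C-P}$ chooses $(Q_t,\eta_t)=\gamma_t(\pi_t)$. Window MDP ($N\ge1$ fixed): $\kappa_t=(\pi_{t-N},I_t^N)$, $I_t^N=(q_{[t-N,t-1]},Q_{[t-N,t-1]},\eta_{[t-N,t-1]})$, with values in $\mathbb{W}=\mathcal{P}(\mathbb{X})\times\mathbb{M}^N\times\mathcal{Q}^N\times\mathcal{H}^N$, for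 $t\ge 0$. $\psi:\mathbb{W}\to\mathcal{P}(\mathbb{X})$ applies $F$ successively $N$ times to the first coordinate with the data in the window, so $\pi_t=\psi(\kappa_t)$. The process $\kappa_t$ is a controlled Markov chain with action $(Q_t,\eta_t)$ and kernel $P(d\kappa'\mid\kappa,Q,\eta)$: given $\kappa_t=(\pi_{t-N},I^N_t)$ and $(Q_t,\eta_t)$, $q_t=q$ with probability $\psi(\kappa_t)(Q_t^{-1}(q))$, the window is shifted by dropping its oldest entry and appending $(q_t,Q_t,\eta_t)$, and the first coordinate becomes $\pi_{t-N+1}=F(\pi_{t-N},Q_{t-N},\eta_{t-N},q_{t-N})$. Stage cost: $c(\kappa,Q,\eta)=\sum_x\psi(\kappa)(x)c(x,\eta(Q,Q(x)))$. $J_\beta(\kappa_0,\gamma)=E^\gamma_{\kappa_0}[\sum_{k\ge0}\beta^kc(\kappa_k,Q_k,\eta_k)]$ and $J_\beta(\kappa_0)$ is its infimum over $\Gamma_{C-FW}$, the policies which at each time $t$ use only $\kappa_t$ to choose $(Q_t,\eta_t)$. Approximation: $\mu\in\mathcal{P}(\mathbb{X})$ is some fixed prior. $\hat{\mathbb{W}}=\{\mu\}\times\mathbb{M}^N\times\mathcal{Q}^N\times\mathcal{H}^N$. $\mathrm{MDP}_N=(\hat{\mathbb{W}},\mathcal{Q}\times\mathcal{H},P_N,c_N)$ where $P_N((\mu,I')\mid(\mu,I),Q,\eta)=P(\mathcal{P}(\mathbb{X})\times\{I'\}\mid(\mu,I),Q,\eta)$ and $c_N(\hat\kappa,Q,\eta)=\sum_x\psi(\hat\kappa)(x)c(x,\eta(Q,Q(x)))$,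 with the same $\beta$. Dobrushin coefficient: $\delta(P,u)=\min_{i,k\in\mathbb{X}}\sum_{j\in\mathbb{X}}\min(P(j\mid i,u),P(j\mid k,u))$.
   Formalization: Added assumption: either μ has full support, or whenever π(Q^{-1}(q))=0 the value F(π,Q,η,q) is some law ν propagated through P(·|·,η(Q,q)); with fully arbitrary values of F there and a general prior μ the bound can fail. *)

(* Defs.v *)
From HB Require Import structures.
From mathcomp Require Import all_boot all_order all_algebra.
From mathcomp Require Import all_classical all_reals all_analysis.

Set Implicit Arguments.
Unset Strict Implicit.
Unset Printing Implicit Defensive.

Import Order.TTheory GRing.Theory Num.Theory.
Import numFieldNormedType.Exports.
Local Open Scope ring_scope.

Record dist (R : realType) (X : finType) := Dist {
  pmf :> X -> R;
  pmf_ge0 : forall x, 0 <= pmf x;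
  pmf_sum1 : \sum_x pmf x = 1 }.

(** Controlled processes whose transitions have finite support: in state [s]
    under action [a], an outcome [y] in the finite type [Y] is drawn with
    probability [p s a y] and the next state is [nxt s a y].  A policy
    [g : nat -> S -> A] chooses the action at time [t] from [t] and the state
    at time [t]. *)

Fixpoint state_after (S A Y : Type) (nxt : S -> A -> Y -> S)
    (g : nat -> S -> A) (s : S) (ys : seq Y) : S :=
  if ys is y :: ys' then
    state_after nxt (fun t => g t.+1) (nxt s (g 0%N s) y) ys'
  else s.

Fixpoint path_prob (R : realType) (S A Y : Type) (p : S -> A -> Y -> R)
    (nxt : S -> A -> Y -> S) (g : nat -> S -> A) (s : S) (ys : seq Y) : R :=
  if ys is y :: ys' then
    p s (g 0%N s) y
      * path_prob p nxt (fun t => g t.+1) (nxt s (g 0%N s) y) ys'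
  else 1.

Definition path_expect (R : realType) (S A : Type) (Y : finType)
    (p : S -> A -> Y -> R) (nxt : S -> A -> Y -> S) (g : nat -> S -> A)
    (s : S) (T : nat) (f : T.-tuple Y -> R) : R :=
  \sum_(ys : T.-tuple Y) path_prob p nxt g s ys * f ys.

(** Since the stage costs used below are bounded and the discount factor is
    less than 1, the expected total discounted cost is the limit of the
    expected discounted costs up to a finite horizon [T]. *)
Definition discounted_cost (R : realType) (S A : Type) (Y : finType)
    (p : S -> A -> Y -> R) (nxt : S -> A -> Y -> S) (cost : S -> A -> R)
    (beta : R) (s : S) (g : nat -> S -> A) : R :=
  limn (fun T : nat => path_expect p nxt g s (fun ys : T.-tuple Y =>
    \sum_(k < T) beta ^+ k *
      (let sk := state_after nxt g s (take k ys) in cost sk (g k sk)))).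

Definition quantizer (X M : finType) := {ffun X -> M}.
Definition controller (X U M : finType) := {ffun quantizer X M * M -> U}.
Definition coding_action (X U M : finType) :=
  (quantizer X M * controller X U M)%type.

(** [symb_prob pi Q q] is pi(Q^{-1}(q)). *)
Definition symb_prob (R : realType) (X M : finType) (pi : dist R X)
    (Q : quantizer X M) (q : M) : R :=
  \sum_(x | Q x == q) pi x.

Definition belief_map (R : realType) (X U M : finType) :=
  dist R X -> quantizer X M -> controller X U M -> M -> dist R X.

(** Nothing is required of [F pi Q eta q] when pi(Q^{-1}(q)) = 0. *)
Definition is_belief_update (R : realType) (X U M : finType)
    (P : X -> U -> dist R X) (F : belief_map R X U M) : Prop :=
  forall pi Q eta q, 0 < symb_prob pi Q q -> forall x',
    F pi Q eta q x' =
      (symb_prob pi Q q)^-1 * \sum_(x | Q x == q) P x (eta (Q, q)) x' * pi x.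

(** On symbols of probability zero, only the conditional law [nu] of the
    current state given the symbol is arbitrary; the known control
    eta(Q, q) is still propagated through [P].

    Some restriction on the null values is needed when the prior of the
    approximation may vanish at some state: a symbol that is null for the
    prior may occur with positive probability for the true belief.  With
    X = M = {0, 1}, N = 1, P(. | x, u) = delta_0 for all x and u, prior
    delta_0 and initial law delta_1, the quantizer id sends the symbol 1, and
    the value F(delta_0, id, eta, 1) = delta_1 makes the approximate
    model evaluate the cost at state 1 although the state is 0, whereas the
    error bound is 0 because the Dobrushin coefficients are 1. *)
Definition null_values_propagated (R : realType) (X U M : finType)
    (P : X -> U -> dist R X) (F : belief_map R X U M) : Prop :=
  forall pi Q eta q, symb_prob pi Q q = 0 ->
    exists nu : dist R X, forall x',
      F pi Q eta q x' = \sum_x P x (eta (Q, q)) x' * nu x.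

(** The three blocks (q_[t-N,t-1], Q_[t-N,t-1], eta_[t-N,t-1]) of a window are
    stored as one tuple of triples, oldest entry first. *)
Definition entry (X U M : finType) := (M * coding_action X U M)%type.
Definition window (X U M : finType) (N : nat) := N.-tuple (entry X U M).
Definition wstate (R : realType) (X U M : finType) (N : nat) :=
  (dist R X * window X U M N)%type.

Definition filter_entry (R : realType) (X U M : finType)
    (F : belief_map R X U M) (pi : dist R X) (e : entry X U M) : dist R X :=
  F pi e.2.1 e.2.2 e.1.

Definition psi (R : realType) (X U M : finType) (N : nat)
    (F : belief_map R X U M) (k : wstate R X U M N) : dist R X :=
  foldl (filter_entry F) k.1 k.2.

Definition stage_cost (R : realType) (X U M : finType) (N : nat)
    (F : belief_map R X U M) (c : X -> U -> R)
    (k : wstate R X U M N) (a : coding_action X U M) : R :=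
  \sum_x psi F k x * c x (a.2 (a.1, a.1 x)).

Definition shift_window (X U M : finType) (N : nat)
    (I : window X U M N) (e : entry X U M) : window X U M N :=
  [tuple of behead (rcons I e)].

Definition w_prob (R : realType) (X U M : finType) (N : nat)
    (F : belief_map R X U M) (k : wstate R X U M N) (a : coding_action X U M)
    (q : M) : R :=
  symb_prob (psi F k) a.1 q.

(** For [0 < N] the default value of [head] is not used. *)
Definition w_next (R : realType) (X U M : finType) (N : nat)
    (F : belief_map R X U M) (k : wstate R X U M N) (a : coding_action X U M)
    (q : M) : wstate R X U M N :=
  (filter_entry F k.1 (head (q, a) k.2), shift_window k.2 (q, a)).

(** The kernel P(B | kappa, Q, eta) of the window process. *)
Definition w_kernel (R : realType) (X U M : finType) (N : nat)
    (F : belief_map R X U M) (k : wstate R X U M N) (a : coding_action X U M)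
    (B : set (wstate R X U M N)) : R :=
  \sum_(q : M | `[< B (w_next F k a q) >]) w_prob F k a q.

(** A policy [g : nat -> wstate R X U M N -> coding_action X U M] uses only the
    current window state (and time). *)
Definition J_W (R : realType) (X U M : finType) (N : nat)
    (F : belief_map R X U M) (c : X -> U -> R) (beta : R)
    (k : wstate R X U M N)
    (g : nat -> wstate R X U M N -> coding_action X U M) : R :=
  discounted_cost (w_prob F) (w_next F) (stage_cost F c) beta k g.

Definition J_W_opt (R : realType) (X U M : finType) (N : nat)
    (F : belief_map R X U M) (c : X -> U -> R) (beta : R)
    (k : wstate R X U M N) : R :=
  inf (range (J_W F c beta k)).

(** The finite model: a state (mu, I) is represented by its window [I]. *)
Definition P_N (R : realType) (X U M : finType) (N : nat)
    (F : belief_map R X U M) (mu : dist R X)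
    (I : window X U M N) (a : coding_action X U M) (I' : window X U M N) : R :=
  w_kernel F (mu, I) a [set k | k.2 = I']%classic.

Definition c_N (R : realType) (X U M : finType) (N : nat)
    (F : belief_map R X U M) (c : X -> U -> R) (mu : dist R X)
    (I : window X U M N) (a : coding_action X U M) : R :=
  stage_cost F c (mu, I) a.

Definition J_N (R : realType) (X U M : finType) (N : nat)
    (F : belief_map R X U M) (c : X -> U -> R) (beta : R) (mu : dist R X)
    (I : window X U M N)
    (g : nat -> window X U M N -> coding_action X U M) : R :=
  discounted_cost (P_N F mu) (fun _ _ I' => I') (c_N F c mu) beta I g.

Definition optimal_N (R : realType) (X U M : finType) (N : nat)
    (F : belief_map R X U M) (c : X -> U -> R) (beta : R) (mu : dist R X)
    (gh : window X U M N -> coding_action X U M) : Prop :=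
  forall (I : window X U M N)
    (g : nat -> window X U M N -> coding_action X U M),
    J_N F c beta mu I (fun _ => gh) <= J_N F c beta mu I g.

Definition extend_policy (R : realType) (X U M : finType) (N : nat)
    (gh : window X U M N -> coding_action X U M) :
    nat -> wstate R X U M N -> coding_action X U M :=
  fun _ k => gh k.2.

(** The source under a policy [g] based on the belief pi_t, with [g 0] used at
    time -N.  The state is (pi_t, conditional law of x_t given the past of the
    source and of the controls); the outcome at time t is the source state
    x_t. *)
Definition src_prob (R : realType) (X U M : finType)
    (s : dist R X * dist R X) (a : coding_action X U M) (x : X) : R := s.2 x.

Definition src_next (R : realType) (X U M : finType)
    (P : X -> U -> dist R X) (F : belief_map R X U M)
    (s : dist R X * dist R X) (a : coding_action X U M) (x : X) :
    dist R X * dist R X :=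
  let q := a.1 x in (F s.1 a.1 a.2 q, P x (a.2 (a.1, q))).

Definition src_policy (R : realType) (X U M : finType)
    (g : nat -> dist R X -> coding_action X U M) :
    nat -> dist R X * dist R X -> coding_action X U M :=
  fun t s => g t s.1.

(** The window state kappa_0 = (pi_{-N}, I_0^N) along the source trajectory
    [xs] = x_[-N,-1]. *)
Definition kappa0 (R : realType) (X U M : finType) (N : nat)
    (P : X -> U -> dist R X) (F : belief_map R X U M)
    (g : nat -> dist R X -> coding_action X U M) (pi : dist R X)
    (xs : N.-tuple X) : wstate R X U M N :=
  (pi, [tuple
     (let s := state_after (src_next P F) (src_policy g) (pi, pi)
                 (take i xs) in
      let a := g i s.1 in (a.1 (tnth xs i), a)) | i < N]).

(** The expectation over kappa_0 when [g] is applied [N] times from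
    x_{-N} ~ [pi]. *)
Definition E_init (R : realType) (X U M : finType) (N : nat)
    (P : X -> U -> dist R X) (F : belief_map R X U M)
    (g : nat -> dist R X -> coding_action X U M) (pi : dist R X)
    (f : wstate R X U M N -> R) : R :=
  path_expect (@src_prob R X U M) (src_next P F) (src_policy g) (pi, pi)
    (fun xs : N.-tuple X => f (kappa0 P F g pi xs)).

(** The values compared below lie in [0, 1] (resp. are nonnegative), so that
    the neutral elements 1 (resp. 0) do not affect minima (resp. maxima) over
    nonempty types. *)
Definition dobrushin (R : realType) (X U : finType) (P : X -> U -> dist R X)
    (u : U) : R :=
  \big[Num.min/1]_(i : X) \big[Num.min/1]_(k : X)
     \sum_(j : X) Num.min (P i u j) (P k u j).

Definition min_dobrushin (R : realType) (X U : finType)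
    (P : X -> U -> dist R X) : R :=
  \big[Num.min/1]_(u : U) dobrushin P u.

Definition cost_norm (R : realType) (X U : finType) (c : X -> U -> R) : R :=
  \big[Num.max/0]_(x : X) \big[Num.max/0]_(u : U) `|c x u|.

(* Main.v *)
Require Import Defs.
From HB Require Import structures.
From mathcomp Require Import all_boot all_order all_algebra.
From mathcomp Require Import all_classical all_reals all_analysis.
From mathcomp Require Import ring lra.
Import Order.TTheory GRing.Theory Num.Theory.
Import numFieldNormedType.Exports.
Local Open Scope classical_set_scope.
Local Open Scope ring_scope.

(** Let V be the optimal value of the finite model, D = |c| / (1 - beta), and
    let the gap of a window state (pi, I) be the l1 distance between the belief
    psi(pi, I) and the approximate belief psi(mu, I).  The window process and the
    finite model move the window in the same way and differ only in the law of
    the current source state, so V satisfies the Bellman equation of the window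
    process up to an error of D times the gap ([bellman_gap]), as an equation for
    the action of the optimal policy and as an inequality for every other action
    ([optimal_le_bellman]).  Unrolling this defect along a trajectory
    ([performance_gap]) bounds the regret of the extended policy with respect to
    any other policy by D times the sum of the discounted expected gaps under
    the two policies ([extension_regret]).

    The expected gap is controlled by the stability of the filter.  If two
    filters, started at pi and nu, are fed the same quantizer, control and
    symbol, with the symbol drawn according to pi, then their expected distance
    is multiplied by at most rho = 2 (1 - delta): conditioning on the symbol
    costs the factor 2 ([conditional_l1]), and the transition kernel contracts
    differences of laws by 1 - delta ([dobrushin_contraction],
    [filter_contraction]).  At every time t >= 0 the two filters have
    shared N entries, starting from beliefs at distance at most 2; hence the
    expected gap is at most 2 rho^N ([expected_gap_init]).  This holds for every
    policy, even one chosen as a function of kappa_0, so the infimum over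
    policies inside the expectation over kappa_0 can be approached for each
    kappa_0 separately.  Summing the two contributions gives
    D * 4 rho^N / (1 - beta).

    The law of kappa_0 is defined from the source; that symbols are then
    distributed according to the beliefs is [source_expect_belief].  Symbols that
    are null for the approximate filter only are dealt with by the condition
    [covers], which holds at the prior under either alternative of the
    hypothesis on null values and is preserved along possible trajectories. *)

Set Implicit Arguments.
Unset Strict Implicit.
Unset Printing Implicit Defensive.

(** * Discounted controlled processes *)

Section ControlledProcess.
Context (R : realType) (S A : Type) (Y : finType).
Context (p : S -> A -> Y -> R) (nxt : S -> A -> Y -> S).
Implicit Types (g : nat -> S -> A) (s : S) (cost : S -> A -> R).

Definition later g : nat -> S -> A := fun t => g t.+1.

(** The expected cost at time [k], by conditioning on the first transition. *)
Fixpoint stage_expect cost g s k : R :=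
  if k is k'.+1 then
    \sum_y p s (g 0%N s) y *
      stage_expect cost (later g) (nxt s (g 0%N s) y) k'
  else cost s (g 0%N s).

Lemma path_expectS g s T (f : T.+1.-tuple Y -> R) :
  path_expect p nxt g s f =
  \sum_y p s (g 0%N s) y *
    path_expect p nxt (later g) (nxt s (g 0%N s) y)
      (fun ys : T.-tuple Y => f [tuple of y :: ys]).
Proof.
rewrite /path_expect.
under [RHS]eq_bigr do rewrite big_distrr /=.
rewrite pair_bigA /=.
rewrite (reindex (fun i : Y * T.-tuple Y => [tuple of i.1 :: i.2])) /=.
  by apply: eq_bigr => -[y ys] _ /=; rewrite mulrA.
exists (fun t : T.+1.-tuple Y => (thead t, [tuple of behead t])).
  by move=> [y ys] _; congr pair; apply: val_inj.
by move=> t _ /=; rewrite -tuple_eta.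
Qed.

Lemma path_expect0 g s (f : 0.-tuple Y -> R) :
  path_expect p nxt g s f = f [tuple].
Proof.
rewrite /path_expect (big_pred1 [tuple]) ?mul1r//= => t.
by apply/esym/eqP; rewrite (tuple0 t); apply/val_inj.
Qed.

Hypothesis p_ge0 : forall s a y, 0 <= p s a y.
Hypothesis p_sum1 : forall s a, \sum_y p s a y = 1.

Lemma mean_const s a (C : R) : \sum_y p s a y * C = C.
Proof. by rewrite -big_distrl /= p_sum1 mul1r. Qed.

Lemma ler_mean s a (f h : Y -> R) :
  (forall y, 0 < p s a y -> f y <= h y) ->
  \sum_y p s a y * f y <= \sum_y p s a y * h y.
Proof.
move=> fh; apply: ler_sum => y _.
have := p_ge0 s a y; rewrite le_eqVlt => /predU1P[<-|py];
  first by rewrite !mul0r.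
by apply: ler_wpM2l; [exact: ltW|exact: fh].
Qed.

Lemma path_expect_affine g s T (a b : R) (f : T.-tuple Y -> R) :
  path_expect p nxt g s (fun ys => a + b * f ys) =
  a + b * path_expect p nxt g s f.
Proof.
elim: T g s f => [|T IH] g s f; first by rewrite !path_expect0.
rewrite !path_expectS; under eq_bigr do rewrite IH mulrDr mulrCA.
by rewrite big_split /= mean_const -big_distrr.
Qed.

Lemma path_expect_le g s T (f h : T.-tuple Y -> R) :
  (forall ys, f ys <= h ys) ->
  path_expect p nxt g s f <= path_expect p nxt g s h.
Proof.
move=> fh; apply: ler_sum => ys _; rewrite ler_wpM2l//.
by elim: (tval ys) g s => [|y l IH] g' s' //=; rewrite mulr_ge0.
Qed.

Lemma path_expect_sum (I : finType) g s T (f : I -> T.-tuple Y -> R) :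
  path_expect p nxt g s (fun ys => \sum_i f i ys) =
  \sum_i path_expect p nxt g s (f i).
Proof. by rewrite exchange_big; apply: eq_bigr => ys _; rewrite big_distrr. Qed.

(** Marginalizing each stage cost over the part of the path after it turns the
    truncated discounted cost into a partial sum of one fixed series, whose
    convergence is then a comparison with the geometric series. *)
Lemma discounted_partial_sum cost (beta : R) g s T :
  path_expect p nxt g s (fun ys : T.-tuple Y =>
    \sum_(k < T) beta ^+ k *
      (let sk := state_after nxt g s (take k ys) in cost sk (g k sk)))
  = \sum_(k < T) beta ^+ k * stage_expect cost g s k.
Proof.
elim: T g s => [|T IH] g s; first by rewrite path_expect0 !big_ord0.
rewrite path_expectS big_ord_recl /= expr0 mul1r.
transitivity (\sum_y p s (g 0%N s) y * (cost s (g 0%N s) + beta *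
    \sum_(k < T) beta ^+ k *
      stage_expect cost (later g) (nxt s (g 0%N s) y) k)).
  apply: eq_bigr => y _; congr (_ * _); rewrite -IH -path_expect_affine.
  apply: eq_bigr => ys _; congr (_ * _).
  rewrite big_ord_recl /= expr0 mul1r; congr (_ + _).
  by rewrite big_distrr; apply: eq_bigr => i _;
    rewrite /= /bump /= add1n exprS -mulrA.
under [LHS]eq_bigr do rewrite mulrDr.
rewrite big_split mean_const; congr (_ + _).
rewrite /=; under eq_bigr do rewrite !big_distrr /=.
rewrite exchange_big /=; apply: eq_bigr => k _.
by rewrite big_distrr; apply: eq_bigr => y _; rewrite /bump /= add1n exprS; ring.
Qed.

Lemma stage_expect_le cost (g : nat -> S -> A) s k (B : R) :
  (forall s a, cost s a <= B) -> stage_expect cost g s k <= B.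
Proof.
move=> hB; elim: k g s => [|k IH] g s //=.
by rewrite -[leRHS](mean_const s (g 0%N s)); apply: ler_mean.
Qed.

Lemma stage_expectN cost g s k :
  stage_expect (fun s a => - cost s a) g s k = - stage_expect cost g s k.
Proof.
elim: k g s => [|k IH] g s //=.
by rewrite -sumrN; apply: eq_bigr => y _; rewrite IH mulrN.
Qed.

Lemma stage_expect_norm cost g s k (B : R) :
  (forall s a, `|cost s a| <= B) -> `|stage_expect cost g s k| <= B.
Proof.
move=> hB; rewrite ler_norml -lerN2 opprK -stage_expectN.
rewrite !stage_expect_le// => s' a; apply: le_trans (hB s' a) => //.
  by rewrite ler_norm.
by rewrite -normrN ler_norm.
Qed.

Section Discounted.
Context (beta : R) (hbeta0 : 0 < beta) (hbeta1 : beta < 1).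
Context (cost : S -> A -> R) (B : R) (hB : forall s a, `|cost s a| <= B).

Local Notation J g s := (discounted_cost p nxt cost beta s g).

Lemma geometric_sum_le (C : R) T : 0 <= C ->
  \sum_(k < T) beta ^+ k * C <= C / (1 - beta).
Proof.
move=> C0; have := @geometric_le_lim R T C beta C0 hbeta0.
rewrite ger0_norm ?(ltW hbeta0)// => /(_ hbeta1); apply: le_trans.
by rewrite seriesEord; apply: ler_sum => k _; rewrite /geometric/= mulrC.
Qed.

Lemma discounted_cost_cvg g s :
  (fun T => \sum_(k < T) beta ^+ k * stage_expect cost g s k) @ \oo --> J g s.
Proof.
rewrite /discounted_cost.
under [X in limn X]eq_fun do rewrite discounted_partial_sum.
suff: cvgn (series (fun k => beta ^+ k * stage_expect cost g s k)).
  by rewrite seriesEord.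
apply: normed_cvg; apply: (@series_le_cvg _ _ (geometric B beta)).
- by move=> n; exact: normr_ge0.
- move=> n; rewrite /geometric/= mulr_ge0 ?exprn_ge0 ?(ltW hbeta0)//.
  exact: le_trans (hB s (g 0%N s)).
- move=> n; rewrite /geometric /= normrM ger0_norm ?exprn_ge0 ?(ltW hbeta0)//.
  by rewrite mulrC ler_wpM2r ?exprn_ge0 ?(ltW hbeta0)// stage_expect_norm.
- by apply: is_cvg_geometric_series; rewrite ger0_norm ?(ltW hbeta0).
Qed.

Lemma discounted_cost_bellman g s :
  J g s = cost s (g 0%N s) +
    beta * \sum_y p s (g 0%N s) y * J (later g) (nxt s (g 0%N s) y).
Proof.
have cv := @discounted_cost_cvg g s.
rewrite -cvg_shiftS in cv.
apply: (cvg_unique (@norm_hausdorff _ _) cv).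
rewrite (_ : [sequence _]_n = fun T => cost s (g 0%N s) + beta * 
  \sum_y p s (g 0%N s) y * \sum_(k < T) beta ^+ k *
     stage_expect cost (later g) (nxt s (g 0%N s) y) k).
  apply: cvgD; first exact: cvg_cst.
  apply: cvgM; first exact: cvg_cst.
  apply: cvg_big => [|y _]; last first.
    by apply: cvgM; [exact: cvg_cst|exact: discounted_cost_cvg].
  exact: add_continuous.
apply/funext => T /=.
rewrite big_ord_recl /= expr0 mul1r; congr (_ + _).
under [in RHS]eq_bigr do rewrite big_distrr /=.
rewrite exchange_big /= big_distrr; apply: eq_bigr => k _ /=.
rewrite /bump /= add1n !big_distrr; apply: eq_bigr => y _ /=.
by rewrite exprS; ring.
Qed.

Lemma discounted_cost_norm g s : `|J g s| <= B / (1 - beta).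
Proof.
have cv := @discounted_cost_cvg g s.
rewrite -(cvg_lim (@norm_hausdorff _ _) (cvg_norm cv)).
apply: limr_le; first exact: cvgP (cvg_norm cv).
apply: nearW => T; apply: le_trans (ler_norm_sum _ _ _) _.
apply: le_trans (geometric_sum_le T (le_trans (normr_ge0 _) (hB s (g 0%N s)))).
apply: ler_sum => k _; rewrite normrM ger0_norm ?exprn_ge0 ?(ltW hbeta0)//.
by rewrite ler_wpM2l ?exprn_ge0 ?(ltW hbeta0)// stage_expect_norm.
Qed.

(** Performance difference.  The error [J g s - W s] is the defect of [W] in
    the Bellman equation at [s] plus [beta] times the mean error at the next
    state, so unrolling [T] steps leaves the discounted expected defects and a
    remainder of order [beta ^+ T].  The sign [sg] makes one induction serve
    for upper and lower bounds. *)
Lemma performance_gap (sg C D : R) (W : S -> R) (e : S -> R) g s T :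
  `|sg| <= 1 -> (forall s, `|W s| <= D) ->
  (forall t s, sg * (cost s (g t s) +
     beta * (\sum_y p s (g t s) y * W (nxt s (g t s) y)) - W s) <= C * e s) ->
  sg * (J g s - W s) <=
    C * (\sum_(k < T) beta ^+ k * stage_expect (fun s _ => e s) g s k)
     + beta ^+ T * (B / (1 - beta) + D).
Proof.
move=> sg1 hD; elim: T g s => [|T IH] g s hg.
  rewrite big_ord0 mulr0 add0r mul1r (le_trans (ler_norm _))// normrM.
  rewrite -[leRHS]mul1r ler_pM// (le_trans (ler_normB _ _))//.
  by rewrite lerD ?discounted_cost_norm.
rewrite discounted_cost_bellman.
set a := g 0%N s.
have -> : sg *
    (cost s a + beta * (\sum_y p s a y * J (later g) (nxt s a y)) - W s)
  = sg * (cost s a + beta * (\sum_y p s a y * W (nxt s a y)) - W s) +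
    beta * \sum_y p s a y * (sg * (J (later g) (nxt s a y) - W (nxt s a y))).
  under [X in _ + beta * X]eq_bigr do rewrite mulrCA mulrBr.
  by rewrite -big_distrr /= sumrB; ring.
rewrite big_ord_recl expr0 mul1r [C * _]mulrDr -[leRHS]addrA lerD ?hg//.
apply: (@le_trans _ _ (beta * \sum_y p s a y * (C *
   (\sum_(k < T) beta ^+ k *
      stage_expect (fun s _ => e s) (later g) (nxt s a y) k)
     + beta ^+ T * (B / (1 - beta) + D)))).
  rewrite ler_wpM2l ?(ltW hbeta0)//; apply: ler_mean => y _.
  by apply: IH => t s'; apply: hg.
under eq_bigr do rewrite mulrDr.
rewrite big_split mean_const mulrDr [beta ^+ T.+1]exprS.
rewrite -(mulrA beta (beta ^+ T)) lerD2r.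
rewrite le_eqVlt; apply/predU1P; left => /=.
under eq_bigr do rewrite big_distrr big_distrr /=.
rewrite exchange_big /= !big_distrr; apply: eq_bigr => k _ /=.
rewrite /bump /= add1n !big_distrr; apply: eq_bigr => y _ /=.
by rewrite exprS; ring.
Qed.

End Discounted.
End ControlledProcess.

(** * Contraction by the Dobrushin coefficient *)

Section Contraction.
Context (R : realType) (X : finType).

Definition l1dist (f h : X -> R) : R := \sum_x `|f x - h x|.

Lemma l1dist_le2 (pi nu : dist R X) : l1dist pi nu <= 2.
Proof.
apply: (@le_trans _ _ (\sum_x (pi x + nu x))).
  apply: ler_sum => x _; apply: le_trans (ler_normB _ _) _.
  by rewrite !ger0_norm ?Defs.pmf_ge0.
by rewrite big_split /= !pmf_sum1.
Qed.

Lemma overlap_l1dist (pi nu : dist R X) :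
  l1dist pi nu = 2 * (1 - \sum_j Num.min (pi j) (nu j)).
Proof.
transitivity (\sum_j (pi j + nu j - 2 * Num.min (pi j) (nu j))).
  by apply: eq_bigr => j _; case: leP => h;
    [rewrite ler0_norm|rewrite ger0_norm]; lra.
rewrite sumrB big_split /= !pmf_sum1 -big_distrr /=; lra.
Qed.

(** A signed vector of total mass zero is the difference of two nonnegative
    vectors [pos] and [neg] of the same mass [m], so its image is the average
    over pairs [(i, k)], weighted by [pos i * neg k / m], of the differences
    [K i - K k] of two rows, each of which has norm at most [2 * (1 - d)]. *)
Lemma dobrushin_contraction (K : X -> dist R X) (d : R) (v : X -> R) :
  (forall i k, d <= \sum_j Num.min (K i j) (K k j)) ->
  \sum_x v x = 0 ->
  \sum_j `|\sum_x K x j * v x| <= (1 - d) * \sum_x `|v x|.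
Proof.
move=> hd v0.
pose pos x := Num.max (v x) 0; pose neg x := Num.max (- v x) 0.
have pos0 x : 0 <= pos x by rewrite /pos le_max lexx orbT.
have neg0 x : 0 <= neg x by rewrite /neg le_max lexx orbT.
have vE x : v x = pos x - neg x.
  by rewrite /pos /neg; case: (leP (v x)); case: (leP (- v x)); lra.
have absE x : `|v x| = pos x + neg x.
  by rewrite /pos /neg; case: (leP (v x)) => h; 
     [rewrite ler0_norm//|rewrite gtr0_norm//]; case: (leP (- v x)); lra.
pose m := \sum_x pos x.
have negm : \sum_x neg x = m.
  apply/esym/eqP; rewrite -subr_eq0 /m -sumrB; apply/eqP; rewrite -[RHS]v0.
  by apply: eq_bigr => x _; rewrite vE.
have -> : \sum_x `|v x| = 2 * m.
  by under eq_bigr do rewrite absE; rewrite big_split /= negm -/m; lra.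
have : 0 <= m by apply: sumr_ge0.
rewrite le_eqVlt => /predU1P[m0|m0].
  rewrite -m0 !mulr0 big1// => j _; rewrite big1 ?normr0// => x _.
  have hp := @psumr_eq0P _ _ _ _ (fun i _ => pos0 i) (esym m0) x isT.
  have hn := @psumr_eq0P _ _ _ _ (fun i _ => neg0 i)
    (etrans negm (esym m0)) x isT.
  by rewrite vE hp hn subrr mulr0.
have key j : m * (\sum_x K x j * v x) =
    \sum_i \sum_k pos i * neg k * (K i j - K k j).
  transitivity (\sum_i (pos i * K i j * m - pos i * \sum_k neg k * K k j)).
    rewrite sumrB -!big_distrl /= -/m [in RHS]mulrC -mulrBr -sumrB.
    by congr (_ * _); apply: eq_bigr => x _; rewrite vE; ring.
  apply: eq_bigr => i _; rewrite -negm !big_distrr -sumrB /=.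
  by apply: eq_bigr => k _; ring.
rewrite -(ler_pM2l m0) big_distrr /=.
apply: (@le_trans _ _ (\sum_j \sum_i \sum_k pos i * neg k * `|K i j - K k j|)).
  apply: ler_sum => j _; rewrite -{1}(gtr0_norm m0) -normrM key.
  apply: le_trans (ler_norm_sum _ _ _) _; apply: ler_sum => i _.
  apply: le_trans (ler_norm_sum _ _ _) _; apply: ler_sum => k _.
  by rewrite normrM ger0_norm// mulr_ge0.
rewrite exchange_big /=.
apply: (@le_trans _ _ (\sum_i \sum_k pos i * neg k * (2 * (1 - d)))).
  apply: ler_sum => i _; rewrite exchange_big /=; apply: ler_sum => k _.
  rewrite -big_distrr /= ler_wpM2l ?mulr_ge0//.
  have := overlap_l1dist (K i) (K k); rewrite /l1dist => ->.
  by have := hd i k; lra.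
rewrite le_eqVlt; apply/predU1P; left.
under eq_bigr do rewrite -big_distrl -big_distrr /= negm.
by rewrite -!big_distrl /= -/m; ring.
Qed.

End Contraction.

(** * One step of the filter *)

Section Filter.
Context (R : realType) (X U M : finType).
Context (P : X -> U -> dist R X) (F : belief_map R X U M).
Implicit Types (pi nu : dist R X) (Q : quantizer X M) (q : M).

Lemma symb_prob_ge0 pi Q q : 0 <= symb_prob pi Q q.
Proof. by apply: sumr_ge0 => x _; exact: Defs.pmf_ge0. Qed.

Lemma symb_prob_sum pi Q (f : M -> R) :
  \sum_q symb_prob pi Q q * f q = \sum_x pi x * f (Q x).
Proof.
rewrite [RHS](partition_big Q xpredT)//=; apply: eq_bigr => q _.
by rewrite /symb_prob big_distrl; apply: eq_bigr => x /eqP->.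
Qed.

Lemma symb_prob_sum1 pi Q : \sum_q symb_prob pi Q q = 1.
Proof.
under eq_bigr do rewrite -[symb_prob _ _ _]mulr1.
by rewrite symb_prob_sum; under eq_bigr do rewrite mulr1; exact: pmf_sum1.
Qed.

Lemma symb_prob_eq0 pi Q q x : symb_prob pi Q q = 0 -> Q x = q -> pi x = 0.
Proof.
move=> h /eqP; apply: (psumr_eq0P _ h) => y _; exact: Defs.pmf_ge0.
Qed.

(** A condition under which the filter started at [nu] stays meaningful on the
    symbols seen by the filter started at [pi]: either null symbols are handled
    by propagating some law, or [pi] is absolutely continuous with respect to
    [nu].  In both cases it survives a filter step on a symbol that has positive
    probability under [pi]. *)
Definition covers nu pi : Prop :=
  null_values_propagated P F \/ (forall x, nu x = 0 -> pi x = 0).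

Hypothesis hF : is_belief_update P F.

(** Multiplying by the probability of the symbol removes the division, and
    makes Bayes' rule hold for null symbols too. *)
Lemma bayes_rule pi Q (eta : controller X U M) q x' :
  symb_prob pi Q q * F pi Q eta q x' =
  \sum_(x | Q x == q) P x (eta (Q, q)) x' * pi x.
Proof.
have := symb_prob_ge0 pi Q q; rewrite le_eqVlt => /predU1P[p0|pgt0].
  rewrite -p0 mul0r big1// => x /eqP Qx.
  by rewrite (symb_prob_eq0 (esym p0) Qx) mulr0.
by rewrite hF// mulrA divff ?mul1r// gt_eqF.
Qed.

Lemma covers_update nu pi Q (eta : controller X U M) q :
  0 < symb_prob pi Q q -> covers nu pi ->
  covers (F nu Q eta q) (F pi Q eta q).
Proof.
move=> pgt0 [h|h]; [by left|right=> x' nu0].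
have /eqP := bayes_rule nu Q eta q x'; rewrite nu0 mulr0 eq_sym.
rewrite psumr_eq0; last by move=> *; rewrite mulr_ge0 ?Defs.pmf_ge0.
move=> /allP/= hz; apply: (mulfI (lt0r_neq0 pgt0)).
rewrite mulr0 bayes_rule big1// => x Qx.
have /implyP/(_ Qx) := hz x (mem_index_enum _).
by rewrite mulf_eq0 => /orP[/eqP->|/eqP/h->]; rewrite ?mul0r ?mulr0.
Qed.

(** Conditioning on a symbol costs a factor 2: replacing [pi] by [nu] on the
    cell of [q] changes both the unnormalized law and its mass, each by at most
    the norm of [pi - nu] on the cell.  If the symbol is null for [nu], then
    [nu] vanishes on the cell and any law [lam] is within twice the mass of
    [pi]. *)
Lemma conditional_l1 nu pi Q (eta : controller X U M) q :
  0 < symb_prob pi Q q -> covers nu pi ->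
  exists lam : X -> R,
    [/\ forall x', F nu Q eta q x' = \sum_x P x (eta (Q, q)) x' * lam x,
        \sum_x lam x = 1 &
        \sum_x `|(if Q x == q then pi x else 0) - symb_prob pi Q q * lam x|
          <= 2 * \sum_(x | Q x == q) `|pi x - nu x| ].
Proof.
move=> pgt0 cov; have := symb_prob_ge0 nu Q q.
rewrite le_eqVlt => /predU1P[n0|ngt0].
  have nu0 x : Q x = q -> nu x = 0 by apply: symb_prob_eq0.
  case: cov => [hnull|hdom]; last first.
    by move: pgt0; rewrite /symb_prob big1 ?ltxx// => x /eqP/nu0/hdom.
  have [lam hlam] := hnull nu Q eta q (esym n0).
  exists lam; split=> //; first exact: pmf_sum1.
  apply: (@le_trans _ _ (\sum_x
      ((if Q x == q then pi x else 0) + symb_prob pi Q q * lam x))).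
    apply: ler_sum => x _; apply: le_trans (ler_normB _ _) _.
    rewrite (@ger0_norm _ (if _ then _ else _)); last first.
      by case: ifP => // _; exact: Defs.pmf_ge0.
    by rewrite ger0_norm// mulr_ge0 ?(ltW pgt0)// Defs.pmf_ge0.
  rewrite big_split /= -big_distrr /= pmf_sum1 mulr1 -big_mkcond /=.
  rewrite -[X in X + _]/(symb_prob pi Q q).
  have -> : \sum_(x | Q x == q) `|pi x - nu x| = symb_prob pi Q q.
    apply: eq_bigr => x /eqP/nu0 ->.
    by rewrite subr0 ger0_norm ?Defs.pmf_ge0.
  by lra.
pose a := symb_prob pi Q q; pose b := symb_prob nu Q q.
have bn0 : b != 0 by rewrite gt_eqF.
exists (fun x => if Q x == q then nu x / b else 0); split.
- move=> x'; rewrite hF// big_distrr big_mkcond; apply: eq_bigr => x _ /=.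
  by case: ifP => _; rewrite -/b; [field|rewrite mulr0].
- by rewrite -big_mkcond -big_distrl /= divff.
rewrite -/a.
rewrite (_ : \sum_x _ = \sum_(x | Q x == q) `|pi x - a * (nu x / b)|); last first.
  rewrite [RHS]big_mkcond; apply: eq_bigr => x _; case: ifP => // _.
  by rewrite mulr0 subr0 normr0.
apply: (@le_trans _ _ (\sum_(x | Q x == q)
    (`|pi x - nu x| + `|b - a| * (nu x / b)))).
  apply: ler_sum => x _.
  have -> : pi x - a * (nu x / b) = (pi x - nu x) + (b - a) * (nu x / b).
    by field.
  apply: le_trans (ler_normD _ _) _; rewrite normrM (@ger0_norm _ (nu x / b))//.
  by rewrite divr_ge0 ?Defs.pmf_ge0 ?ltW.
rewrite big_split /= -big_distrr -big_distrl /= -/b divff// mulr1.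
suff : `|b - a| <= \sum_(x | Q x == q) `|pi x - nu x| by lra.
by rewrite distrC /a /b /symb_prob -sumrB ler_norm_sum.
Qed.

Lemma min_dobrushin_le u i k :
  min_dobrushin P <= \sum_j Num.min (P i u j) (P k u j).
Proof. by do 3 apply: (bigmin_inf) => //. Qed.

Lemma min_dobrushin_le1 : min_dobrushin P <= 1.
Proof. exact: bigmin_le_id. Qed.

(** One step of filter stability: when symbols are drawn from [pi], the factor
    2 of conditioning is followed by the Dobrushin contraction of the transition
    kernel, which sees a difference of two conditional laws. *)
Lemma filter_contraction nu pi Q (eta : controller X U M) : covers nu pi ->
  \sum_q symb_prob pi Q q * l1dist (F pi Q eta q) (F nu Q eta q)
  <= 2 * (1 - min_dobrushin P) * l1dist pi nu.
Proof.
move=> cov.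
rewrite {2}/l1dist (partition_big Q xpredT)//= big_distrr /=.
apply: ler_sum => q _.
have := symb_prob_ge0 pi Q q; rewrite le_eqVlt => /predU1P[p0|pgt0].
  rewrite -p0 mul0r mulr_ge0 ?sumr_ge0//.
  by rewrite mulr_ge0 ?subr_ge0 ?min_dobrushin_le1.
have [lam [Flam lam1 hlam]] := conditional_l1 eta pgt0 cov.
pose v x := (if Q x == q then pi x else 0) - symb_prob pi Q q * lam x.
have v0 : \sum_x v x = 0.
  by rewrite sumrB -big_distrr /= lam1 mulr1 -big_mkcond subrr.
have := dobrushin_contraction (min_dobrushin_le (eta (Q, q))) v0.
move=> h; apply: le_trans (le_trans h _).
  rewrite /l1dist big_distrr /=; apply: ler_sum => x' _.
  rewrite -{1}(gtr0_norm pgt0) -normrM mulrBr bayes_rule Flam.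
  rewrite le_eqVlt; apply/predU1P; left; congr (`|_|).
  rewrite big_mkcond big_distrr -sumrB; apply: eq_bigr => x _ /=.
  by rewrite /v; case: ifP => _; ring.
by rewrite -mulrA mulrCA ler_wpM2l ?subr_ge0 ?min_dobrushin_le1.
Qed.

End Filter.

(** * Filter stability along belief trajectories *)

Section BeliefProcess.
Context (R : realType) (X U M : finType).
Context (P : X -> U -> dist R X) (F : belief_map R X U M).
Hypothesis hF : is_belief_update P F.
Implicit Types (g : nat -> dist R X -> coding_action X U M).
Implicit Types (pi nu : dist R X).

Local Notation rho := (2 * (1 - min_dobrushin P)).
Local Notation run := (foldl (filter_entry F)).

Lemma rho_ge0 : 0 <= rho.
Proof. by rewrite mulr_ge0// subr_ge0 min_dobrushin_le1. Qed.

(** Expectation of a function of the list of entries generated by the policy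
    when each symbol is drawn from the current belief. *)
Fixpoint belief_expect g pi n (f : seq (entry X U M) -> R) : R :=
  if n is n'.+1 then
    let a := g 0%N pi in
    \sum_q symb_prob pi a.1 q *
      belief_expect (later g) (F pi a.1 a.2 q) n' (fun l => f ((q, a) :: l))
  else f [::].

Lemma belief_expect_le_const g pi n f (B : R) :
  (forall l, f l <= B) -> belief_expect g pi n f <= B.
Proof.
elim: n g pi f => [|n IH] g pi f hB //=.
apply: (@le_trans _ _ (\sum_q symb_prob pi (g 0%N pi).1 q * B)).
  by apply: ler_sum => q _; rewrite ler_wpM2l ?symb_prob_ge0// IH.
by rewrite -big_distrl /= symb_prob_sum1 mul1r.
Qed.

(** Two filters fed the same entries approach each other at rate [rho] on
    average, when the entries are generated by the first one.  The bound on [f]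
    is required only on the histories where the two beliefs can be compared. *)
Lemma belief_expect_forget g pi nu n f (C : R) :
  0 <= C -> covers P F nu pi ->
  (forall l, covers P F (run nu l) (run pi l) ->
     f l <= C * l1dist (run pi l) (run nu l)) ->
  belief_expect g pi n f <= C * (rho ^+ n * l1dist pi nu).
Proof.
move=> C0; elim: n g pi nu f => [|n IH] g pi nu f cov hf /=.
  by rewrite mul1r; apply: (hf [::]).
set a := g 0%N pi.
apply: (@le_trans _ _ (\sum_q symb_prob pi a.1 q *
   (C * (rho ^+ n * l1dist (F pi a.1 a.2 q) (F nu a.1 a.2 q))))).
  apply: ler_sum => q _; have := symb_prob_ge0 pi a.1 q.
  rewrite le_eqVlt => /predU1P[<-|pgt0]; first by rewrite !mul0r.
  rewrite ler_wpM2l ?symb_prob_ge0//; apply: IH.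
    exact: covers_update.
  by move=> l; apply: (hf ((q, a) :: l)).
under eq_bigr do rewrite !(mulrCA (symb_prob _ _ _)).
rewrite -!big_distrr /= ler_wpM2l// exprSr -mulrA ler_wpM2l ?exprn_ge0 ?rho_ge0//.
exact: filter_contraction.
Qed.

(** The second filter starts at [mu] only after [m] entries; whatever happened
    before, the two beliefs are then at distance at most 2. *)
Lemma belief_expect_reset (mu : dist R X) g pi m n f (C : R) :
  0 <= C -> (forall pi, covers P F mu pi) ->
  (forall l, covers P F (run mu (drop m l)) (run pi l) ->
     f l <= C * l1dist (run pi l) (run mu (drop m l))) ->
  belief_expect g pi (m + n) f <= C * (rho ^+ n * 2).
Proof.
move=> C0 hmu; elim: m g pi f => [|m IH] g pi f hf.
  apply: le_trans (belief_expect_forget _ _ C0 (hmu pi) _) _.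
    by move=> l; have := hf l; rewrite drop0.
  by rewrite ler_wpM2l// ler_wpM2l ?exprn_ge0 ?rho_ge0// l1dist_le2.
rewrite addSn /=; set a := g 0%N pi.
apply: (@le_trans _ _ (\sum_q symb_prob pi a.1 q * (C * (rho ^+ n * 2)))).
  apply: ler_sum => q _; rewrite ler_wpM2l ?symb_prob_ge0//; apply: IH.
  by move=> l; apply: (hf ((q, a) :: l)).
by rewrite -big_distrl /= symb_prob_sum1 mul1r.
Qed.

Local Notation source_expect g s f :=
  (path_expect (@src_prob R X U M) (src_next P F) (src_policy g) s f).

(** The true conditional law of the source enters a path expectation only
    through the first drawn state, hence linearly. *)
Lemma source_expect_mix g pi n (f : n.-tuple X -> R) (I : finType)
    (D : pred I) (w : I -> R) (lam : I -> dist R X) (c : R) (lam0 : dist R X) :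
  (forall x, c * lam0 x = \sum_(i | D i) lam i x * w i) ->
  c * source_expect g (pi, lam0) f =
  \sum_(i | D i) w i * source_expect g (pi, lam i) f.
Proof.
move=> mix; case: n f => [|n] f.
  rewrite path_expect0; under eq_bigr do rewrite path_expect0.
  rewrite -big_distrl /=; congr (_ * _).
  rewrite -[LHS]mulr1 -(pmf_sum1 lam0) big_distrr /=.
  under eq_bigr do rewrite mix.
  rewrite exchange_big; apply: eq_bigr => i _ /=.
  by rewrite -big_distrl /= pmf_sum1 mul1r.
rewrite path_expectS; under [RHS]eq_bigr do rewrite path_expectS.
rewrite big_distrr; under [RHS]eq_bigr do rewrite big_distrr.
rewrite exchange_big; apply: eq_bigr => x _ /=.
rewrite /src_prob /= mulrA mix big_distrl; apply: eq_bigr => i _ /=.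
by rewrite mulrA (mulrC (w i)).
Qed.

Fixpoint entries g pi (xs : seq X) : seq (entry X U M) :=
  if xs is x :: xs' then
    let a := g 0%N pi in
    (a.1 x, a) :: entries (later g) (F pi a.1 a.2 (a.1 x)) xs'
  else [::].

(** The belief is the conditional law of the source given the symbols:
    grouping the source states by their symbol, Bayes' rule replaces the mixture
    of the laws of the next state over a cell by the updated belief. *)
Lemma source_expect_belief g pi n f :
  source_expect g (pi, pi) (fun xs : n.-tuple X => f (entries g pi xs)) =
  belief_expect g pi n f.
Proof.
elim: n g pi f => [|n IH] g pi f; first by rewrite path_expect0.
rewrite path_expectS /= /src_policy /=; set a := g 0%N pi.
rewrite (partition_big a.1 xpredT)//=; apply: eq_bigr => q _.
rewrite -IH.
rewrite (source_expect_mix _ _ _ (fun x' => bayes_rule hF pi a.1 a.2 q x')).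
by apply: eq_bigr => x /eqP Qx; rewrite /src_prob /src_next /= Qx.
Qed.

Lemma kappa0_entries g pi N (xs : N.-tuple X) :
  tval (kappa0 P F g pi xs).2 = entries g pi xs.
Proof.
rewrite /kappa0 /=.
rewrite -[pi in RHS]/((pi, pi).1); move: (pi, pi) => s; clear pi.
elim: N g s xs => [|N IH] g s xs; first by rewrite (tuple0 xs) enum_ord0.
case/tupleP: xs => x xs; rewrite enum_ordSl /=.
rewrite -(IH (later g) (src_next P F s (g 0%N s.1) x)) -map_comp.
by congr (_ :: _); apply: eq_map => i /=; rewrite tnthS.
Qed.

Lemma E_init_le N g pi (f : wstate R X U M N -> R) f' :
  (forall I, f (pi, I) <= f' (tval I)) ->
  E_init P F g pi f <= belief_expect g pi N f'.
Proof.
move=> ff'; rewrite -source_expect_belief; apply: path_expect_le.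
  by move=> s a x; exact: Defs.pmf_ge0.
by move=> xs; rewrite -(kappa0_entries g pi xs); exact: ff'.
Qed.

End BeliefProcess.

(** * The window process and its finite approximation *)

Section WindowProcess.
Context (R : realType) (X U M : finType) (N : nat).
Context (P : X -> U -> dist R X) (F : belief_map R X U M) (mu : dist R X).
Hypotheses (hF : is_belief_update P F) (hN : (0 < N)%N).
Hypothesis hmu : forall pi, covers P F mu pi.
Implicit Types (k : wstate R X U M N) (I : window X U M N).
Implicit Types (a : coding_action X U M).
Implicit Types (g : nat -> wstate R X U M N -> coding_action X U M).

Local Notation rho := (2 * (1 - min_dobrushin P)).
Local Notation run := (foldl (filter_entry F)).

Lemma w_prob_ge0 k a q : 0 <= w_prob F k a q.
Proof. exact: symb_prob_ge0. Qed.

Lemma w_prob_sum1 k a : \sum_q w_prob F k a q = 1.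
Proof. exact: symb_prob_sum1. Qed.

Lemma psi_next k a q : psi F (w_next F k a q) = F (psi F k) a.1 a.2 q.
Proof.
case: k => pi [[|e l] /= sz]; first by exfalso; move: hN; rewrite -(eqP sz).
by rewrite /psi /w_next /shift_window /= foldl_rcons.
Qed.

Lemma drop_shift_window I (e : entry X U M) t : (t < N)%N ->
  drop t (shift_window I e) = rcons (drop t.+1 I) e.
Proof.
case: I => -[|e' l] /= sz tN; first by exfalso; move: hN; rewrite -(eqP sz).
by rewrite drop_rcons// -ltnS; move: tN; rewrite -(eqP sz).
Qed.

(** The error made by forgetting the belief at the start of the window and
    using the prior instead. *)
Definition window_gap k : R := l1dist (psi F k) (psi F (mu, k.2)).

Local Notation expected_gap g k t :=
  (stage_expect (w_prob F) (w_next F) (fun s _ => window_gap s) g k t).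

Lemma expected_gap_le2 g k t : expected_gap g k t <= 2.
Proof.
apply: stage_expect_le => *; [exact: w_prob_ge0|exact: w_prob_sum1|].
exact: l1dist_le2.
Qed.

(** For [t <= N], the window at time [t] still contains all but the first [t]
    entries of the initial one.  So the approximate filter at time [t] is the
    filter started at [run mu (drop t k.2)] and fed the [t] new entries. *)
Lemma expected_gap_partial g k t : (t <= N)%N ->
  covers P F (run mu (drop t k.2)) (psi F k) ->
  expected_gap g k t <= rho ^+ t * l1dist (psi F k) (run mu (drop t k.2)).
Proof.
elim: t g k => [|t IH] g k tN cov /=; first by rewrite drop0 mul1r.
set a := g 0%N k.
pose nu := run mu (drop t.+1 k.2).
have runE q : run mu (drop t (w_next F k a q).2) = F nu a.1 a.2 q.
  by rewrite drop_shift_window// foldl_rcons.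
apply: (@le_trans _ _ (\sum_q symb_prob (psi F k) a.1 q *
  (rho ^+ t * l1dist (F (psi F k) a.1 a.2 q) (F nu a.1 a.2 q)))).
  apply: ler_sum => q _; rewrite -[w_prob _ _ _ _]/(symb_prob (psi F k) a.1 q).
  have := symb_prob_ge0 (psi F k) a.1 q.
  rewrite le_eqVlt => /predU1P[<-|pgt0]; first by rewrite !mul0r.
  rewrite ler_wpM2l ?symb_prob_ge0// -psi_next -runE; apply: IH.
    exact: ltnW.
  by rewrite psi_next runE; exact: covers_update.
under eq_bigr do rewrite mulrCA.
rewrite -big_distrr /= exprSr -mulrA ler_wpM2l ?exprn_ge0 ?rho_ge0//.
exact: filter_contraction.
Qed.

(** After [N] steps the window consists of new entries only, and the distance
    at its start is at most 2 whatever the state and the policy. *)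
Lemma expected_gap_late g k t : (N <= t)%N ->
  expected_gap g k t <= 2 * rho ^+ N.
Proof.
move=> /subnK <-; elim: (t - N)%N g k => [|n IH] g k.
  rewrite add0n; have dN : drop N k.2 = [::] by rewrite drop_oversize ?size_tuple.
  have := @expected_gap_partial g k N (leqnn N); rewrite dN => /(_ (hmu _)) h.
  by rewrite (le_trans h)// mulrC ler_wpM2r ?exprn_ge0 ?rho_ge0// l1dist_le2.
rewrite addSn /= -[leRHS](mean_const w_prob_sum1 k (g 0%N k)).
by apply: (ler_mean w_prob_ge0) => q _; exact: IH.
Qed.

(** The policy used after time 0 may depend on the whole initial state: this is
    what allows a different nearly optimal policy for each [kappa_0].  For
    [t < N] the window at time [t] starts at time [t - N], so the contraction
    is gained partly on the [N - t] last steps before time 0 and partly on the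
    [t] steps after it. *)
Lemma expected_gap_init (h : nat -> dist R X -> coding_action X U M) pi
    (G : wstate R X U M N -> nat -> wstate R X U M N -> coding_action X U M) t :
  E_init P F h pi (fun k => expected_gap (G k) k t) <= 2 * rho ^+ N.
Proof.
have [Nt|/ltnW tN] := leqP N t.
  apply: le_trans (E_init_le hF h (f' := fun=> 2 * rho ^+ N) _) _.
    by move=> I; exact: expected_gap_late.
  exact: belief_expect_le_const.
(* On histories that have probability 0 the two beliefs may not be comparable,
   and the trivial bound 2 is used. *)
pose f' (l : seq (entry X U M)) : R :=
  if `[< covers P F (run mu (drop t l)) (run pi l) >]
  then rho ^+ t * l1dist (run pi l) (run mu (drop t l)) else 2.
apply: le_trans (E_init_le hF h (f' := f') _) _.
  move=> I; rewrite /f'; case: asboolP => [cov|_].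
    exact: (@expected_gap_partial _ (pi, I)).
  exact: expected_gap_le2.
have rt0 : 0 <= rho ^+ t by rewrite exprn_ge0 ?rho_ge0.
rewrite -{1}(subnKC tN).
apply: le_trans (belief_expect_reset hF h (N - t) rt0 hmu _) _.
  by move=> l cov; rewrite /f'; case: asboolP.
by rewrite mulrA -exprD subnKC// mulrC.
Qed.

Context (c : X -> U -> R).
Local Notation B := (cost_norm c).

Lemma cost_norm_ge x u : `|c x u| <= B.
Proof. by apply: (bigmax_sup x) => //; apply: (bigmax_sup u). Qed.

Lemma dist_mean_norm (pi : dist R X) (f : X -> R) (C : R) :
  (forall x, `|f x| <= C) -> `|\sum_x pi x * f x| <= C.
Proof.
move=> hf; apply: le_trans (ler_norm_sum _ _ _) _.
rewrite -[leRHS]mul1r -(pmf_sum1 pi) big_distrl; apply: ler_sum => x _ /=.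
by rewrite normrM ger0_norm ?Defs.pmf_ge0// ler_wpM2l ?Defs.pmf_ge0.
Qed.

Lemma stage_cost_norm k a : `|stage_cost F c k a| <= B.
Proof. by apply: dist_mean_norm => x; exact: cost_norm_ge. Qed.

Lemma P_N_sum I a (f : window X U M N -> R) :
  \sum_I' P_N F mu I a I' * f I' =
  \sum_q w_prob F (mu, I) a q * f (shift_window I (q, a)).
Proof.
rewrite [RHS](partition_big (fun q => shift_window I (q, a)) xpredT)//=.
apply: eq_bigr => I' _; rewrite /P_N /w_kernel big_distrl /=.
apply: eq_big => [q|q /asboolP /= <-//].
by apply/asboolP/eqP.
Qed.

Lemma P_N_ge0 I a I' : 0 <= P_N F mu I a I'.
Proof. by apply: sumr_ge0 => q _; exact: w_prob_ge0. Qed.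

Lemma P_N_sum1 I a : \sum_I' P_N F mu I a I' = 1.
Proof.
under eq_bigr do rewrite -[P_N _ _ _ _ _]mulr1.
by rewrite P_N_sum; under eq_bigr do rewrite mulr1; exact: w_prob_sum1.
Qed.

Context (beta : R) (hbeta0 : 0 < beta) (hbeta1 : beta < 1).
Local Notation D := (B / (1 - beta)).

(** The right-hand side of the Bellman equation; at the state [(mu, I)] it is
    that of the finite model. *)
Definition bellman k a (V : window X U M N -> R) : R :=
  stage_cost F c k a +
  beta * \sum_q w_prob F k a q * V (shift_window k.2 (q, a)).

(** Both sides are means of the same function of the source state, bounded by
    [cost_norm c + beta * (cost_norm c / (1 - beta)) = cost_norm c / (1 - beta)],
    under the true and under the approximate belief. *)
Lemma bellman_gap k a V : (forall I, `|V I| <= D) ->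
  `|bellman k a V - bellman (mu, k.2) a V| <= D * window_gap k.
Proof.
move=> hV.
pose f x := c x (a.2 (a.1, a.1 x)) + beta * V (shift_window k.2 (a.1 x, a)).
have E k' : k'.2 = k.2 -> bellman k' a V = \sum_x psi F k' x * f x.
  move=> e; rewrite /bellman e /w_prob symb_prob_sum big_distrr -big_split /=.
  by apply: eq_bigr => x _; rewrite /f; ring.
rewrite !E// -sumrB; apply: le_trans (ler_norm_sum _ _ _) _.
rewrite /window_gap /l1dist big_distrr; apply: ler_sum => x _ /=.
rewrite -mulrBl normrM mulrC ler_wpM2r//.
apply: le_trans (ler_normD _ _) _.
have -> : D = B + beta * D by field; rewrite subr_eq0 gt_eqF.
by rewrite lerD ?cost_norm_ge// normrM gtr0_norm// ler_wpM2l ?(ltW hbeta0).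
Qed.

Lemma J_N_norm I h : `|J_N F c beta mu I h| <= D.
Proof.
apply: discounted_cost_norm => // *; first exact: P_N_ge0.
  exact: P_N_sum1.
exact: stage_cost_norm.
Qed.

Lemma J_W_norm k g : `|J_W F c beta k g| <= D.
Proof.
apply: discounted_cost_norm => // *; first exact: w_prob_ge0.
  exact: w_prob_sum1.
exact: stage_cost_norm.
Qed.

Lemma J_N_bellman I h :
  J_N F c beta mu I h =
  bellman (mu, I) (h 0%N I) (fun I' => J_N F c beta mu I' (later h)).
Proof.
rewrite /J_N (@discounted_cost_bellman _ _ _ _ _ _ _ _ _ _ _ _ B) => // *.
- by rewrite P_N_sum.
- exact: P_N_ge0.
- exact: P_N_sum1.
- exact: stage_cost_norm.
Qed.

Context (gh : window X U M N -> coding_action X U M).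
Hypothesis hgh : optimal_N F c beta mu gh.
Local Notation V := (fun I => J_N F c beta mu I (fun _ => gh)).

(** Compare with the policy that plays [a] once and follows [gh] afterwards. *)
Lemma optimal_le_bellman I a : V I <= bellman (mu, I) a V.
Proof.
have := @hgh I (fun t => if t is 0%N then fun=> a else gh).
by rewrite [leRHS]J_N_bellman.
Qed.

(** The value [V] of the finite model, read on the window component, solves its
    Bellman equation for the action of [gh] and lies below it for every other
    action.  Its defect in the true model is thus bounded by the window gap, from
    above along [gh] and from below along [g]. *)
Lemma extension_regret k g T :
  J_W F c beta k (extend_policy gh) - J_W F c beta k g <=
  D * (\sum_(t < T) beta ^+ t *
        (expected_gap (extend_policy gh) k t + expected_gap g k t))
  + beta ^+ T * (4 * D).
Proof.
have hV I : `|V I| <= D by exact: J_N_norm.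
have gap := performance_gap (nxt := w_next F) w_prob_ge0 w_prob_sum1
  hbeta0 hbeta1 stage_cost_norm.
have up := gap 1 D D (fun k => V k.2) window_gap (extend_policy gh) k T.
have lo := gap (-1) D D (fun k => V k.2) window_gap g k T.
have {up} : J_W F c beta k (extend_policy gh) - V k.2 <=
    D * (\sum_(t < T) beta ^+ t * expected_gap (extend_policy gh) k t)
    + beta ^+ T * (D + D).
  rewrite -[leLHS]mul1r; apply: up; [by rewrite normr1|by []|move=> t s].
  rewrite mul1r [X in _ - X]J_N_bellman.
  by apply: le_trans (bellman_gap _ _ hV); exact: ler_norm.
have {lo} : V k.2 - J_W F c beta k g <=
    D * (\sum_(t < T) beta ^+ t * expected_gap g k t) + beta ^+ T * (D + D).
  rewrite -opprB -mulN1r; apply: lo; [by rewrite normrN1|by []|move=> t s].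
  rewrite mulN1r opprB.
  apply: le_trans (lerB (optimal_le_bellman _ (g t s)) (lexx _)) _.
  by apply: le_trans (bellman_gap _ _ hV); rewrite distrC; exact: ler_norm.
under [in X in _ -> _ -> X]eq_bigr do rewrite mulrDr.
by rewrite big_split mulrDr /=; lra.
Qed.

Lemma near_optimal k (e : R) : 0 < e ->
  exists g, J_W F c beta k g < J_W_opt F c beta k + e.
Proof.
move=> e0; have hinf : has_inf (range (J_W F c beta k)).
  split.
    by exists (J_W F c beta k (extend_policy gh)); exists (extend_policy gh).
  exists (- D) => _ [g _ <-]; have := J_W_norm k g.
  by rewrite ler_norml => /andP[].
have [_ [g _ <-] hg] := inf_adherent e0 hinf.
by exists g.
Qed.

End WindowProcess.

(** * The performance bound *)

Theorem mainTheorem8 (R : realType) (X U M : finType)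
  (hX : (0 < #|X|)%N) (hU : (0 < #|U|)%N) (hM : (0 < #|M|)%N)
  (P : X -> U -> dist R X) (c : X -> U -> R)
  (beta : R) (hbeta0 : 0 < beta) (hbeta1 : beta < 1)
  (N : nat) (hN : (1 <= N)%N)
  (F : belief_map R X U M) (hF : is_belief_update P F)
  (mu : dist R X)
  (hnull : (forall x, 0 < mu x) \/ null_values_propagated P F)
  (gh : window X U M N -> coding_action X U M) (hgh : optimal_N F c beta mu gh)
  (piN : dist R X) (g : nat -> dist R X -> coding_action X U M) :
  E_init P F g piN
    (fun k0 : wstate R X U M N =>
       J_W F c beta k0 (extend_policy gh) - J_W_opt F c beta k0)
  <= 4 * cost_norm c / (1 - beta) ^+ 2
     * (2 * (1 - min_dobrushin P)) ^+ N.
Proof.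
have hmu pi : covers P F mu pi.
  by case: hnull => h; [right=> x h0; move: (h x); rewrite h0 ltxx|left].
set D := cost_norm c / (1 - beta).
set rhoN := (2 * (1 - min_dobrushin P)) ^+ N.
have D0 : 0 <= D.
  by rewrite divr_ge0 ?subr_ge0 ?(ltW hbeta1)//; exact: bigmax_ge_id.
have rhoN0 : 0 <= rhoN by rewrite exprn_ge0 ?rho_ge0.
rewrite (_ : _ * rhoN = D * (4 * rhoN / (1 - beta))); last first.
  by rewrite /D; field; rewrite subr_eq0 gt_eqF.
(* The truncation at [T] and the choice of [beta ^+ T]-optimal policies below
   leave an error that vanishes as [T] grows. *)
suff bound T : E_init P F g piN (fun k0 : wstate R X U M N =>
    J_W F c beta k0 (extend_policy gh) - J_W_opt F c beta k0)
  <= beta ^+ T * (4 * D + 1) + D * (4 * rhoN / (1 - beta)).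
  have cv : (fun T => beta ^+ T * (4 * D + 1) + D * (4 * rhoN / (1 - beta)))
      @ \oo --> 0 * (4 * D + 1) + D * (4 * rhoN / (1 - beta)).
    apply: cvgD; last exact: cvg_cst.
    apply: cvgM; last exact: cvg_cst.
    by apply: cvg_expr; rewrite gtr0_norm.
  rewrite -[leRHS]add0r -[X in X + _](mul0r (4 * D + 1)).
  rewrite -(cvg_lim (@norm_hausdorff _ _) cv).
  by apply: limr_ge; [exact: cvgP cv|exact: nearW].
have bT0 : 0 < beta ^+ T by rewrite exprn_gt0.
have [G hG] := choice (fun k0 : wstate R X U M N =>
  near_optimal F c hbeta0 hbeta1 gh k0 bT0).
pose gap (h : nat -> wstate R X U M N -> coding_action X U M) k0 t :=
  stage_expect (w_prob F) (w_next F) (fun s _ => window_gap F mu s) h k0 t.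
pose e (t : 'I_T) (k0 : wstate R X U M N) :=
  beta ^+ t * (gap (extend_policy gh) k0 t + gap (G k0) k0 t).
apply: (@le_trans _ _ (E_init P F g piN (fun k0 : wstate R X U M N =>
    beta ^+ T * (4 * D + 1) + D * \sum_(t < T) e t k0))).
  apply: path_expect_le => [s a x|xs]; first exact: Defs.pmf_ge0.
  move: (kappa0 _ _ _ _ _) => k0.
  have := extension_regret hbeta0 hbeta1 hgh k0 (G k0) T.
  by have := hG k0; rewrite /e /gap -/D; lra.
rewrite /E_init path_expect_affine; last first.
  by move=> s a; exact: pmf_sum1.
rewrite lerD2l ler_wpM2l// path_expect_sum.
apply: le_trans (geometric_sum_le hbeta0 hbeta1 T _); last by rewrite mulr_ge0.
apply: ler_sum => t _.
have gap_init h := expected_gap_init hF hN hmu g piN h t.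
have := lerD (gap_init (fun _ => extend_policy gh)) (gap_init G).
rewrite /E_init /path_expect -big_split /= -/rhoN => le4.
have -> : 4 * rhoN = 2 * rhoN + 2 * rhoN by ring.
apply: le_trans (ler_wpM2l (exprn_ge0 t (ltW hbeta0)) le4).
rewrite big_distrr le_eqVlt; apply/predU1P; left; apply: eq_bigr => xs _ /=.
by rewrite /e /gap; ring.
Qed.
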